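(* Let $\lambda$ be a nonzero real number. For all integers $n\ge 0$, $$J_{n,\lambda}(x)=\sum_{m=0}^{n}\binom{n}{m}L_{n-m,\lambda}(x)\sum_{k=0}^{m}(1)_{k,\lambda}{m \brack k}_{-\lambda}.$$
   Context: All identities are between polynomials in an indeterminate $x$ with real coefficients. For nonzero real $\lambda$, $(x)_{0,\lambda}=1$ and $(x)_{k,\lambda}=x(x-\lambda)(x-2\lambda)\cdots(x-(k-1)\lambda)$ for $k\ge 1$; $(1)_{k,\lambda}$ is its value at $x=1$. For $n\ge 0$, $K_{n,\lambda}(x)=n!\sum_{k=0}^{n}\binom{n+k+1}{n-k}\frac{(x)_{k,\lambda}}{k!}$; $J_{n,\lambda}(x)=K_{n,\lambda}(x)-nK_{n-1,\lambda}(x)$; and $L_{n,\lambda}(x)=J_{n,\lambda}(x)-nJ_{n-1,\lambda}(x)$, where for $n=0$ the second terms are read as $0$, so $J_{0,\lambda}(x)=L_{0,\lambda}(x)=1$. For any nonzero real $\mu$, the degenerate logarithm is the power series $\log_\mu(1+t)=\frac{1}{\mu}\left((1+t)^\mu-1\right)$, and the unsigned degenerate Stirling numbers of the first kind ${n \brack k}_\mu$ are defined by $\frac{1}{k!}\left(-\log_\mu(1-t)\right)^k=\sum_{n=k}^{\infty}{n \brack k}_\mu\frac{t^n}{n!}$ for $k\ge 0$. In the claim this is used with $\mu=-\lambda$. *)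

(* Defs.v *)
From HB Require Import structures.
From mathcomp Require Import all_boot all_order all_algebra.
From mathcomp Require Import reals.
Set Implicit Arguments.
Unset Strict Implicit.
Unset Printing Implicit Defensive.
Import Order.TTheory GRing.Theory Num.Theory.
Local Open Scope ring_scope.

(* A formal power series \sum_n a_n t^n is its coefficient sequence
   n |-> a_n. *)
Definition fps (R : Type) := nat -> R.

Section FormalPowerSeries.
Variable R : fieldType.
Implicit Types (f g : fps R) (mu c : R).

Definition fps_one : fps R := fun n => (n == 0)%:R.

Definition fps_sub f g : fps R := fun n => f n - g n.

Definition fps_scale c f : fps R := fun n => c * f n.

Definition fps_mul f g : fps R := fun n => \sum_(i < n.+1) f i * g (n - i)%N.

Definition fps_exp f (k : nat) : fps R := iter k (fps_mul f) fps_one.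

(* f(t) |-> f(-t) *)
Definition fps_neg_var f : fps R := fun n => (-1) ^+ n * f n.

(* (1 + t)^mu, as the binomial series. *)
Definition fps_binomial mu : fps R :=
  fun n => (\prod_(i < n) (mu - i%:R)) / n`!%:R.

(* log_mu(1 + t), meaningful for mu != 0. *)
Definition degenerate_log mu : fps R :=
  fps_scale mu^-1 (fps_sub (fps_binomial mu) fps_one).

(* n! times the coefficient of t^n in (- log_mu(1 - t))^k / k!. *)
Definition degenerate_stirling1 mu (n k : nat) : R :=
  n`!%:R * fps_scale k`!%:R^-1
    (fps_exp (fps_scale (-1) (fps_neg_var (degenerate_log mu))) k) n.

(* The generating series has no terms of degree n < k, as required by a
   defining sum that starts at n = k. *)
Lemma degenerate_stirling1_small mu n k :
  (n < k)%N -> degenerate_stirling1 mu n k = 0.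
Proof.
rewrite /degenerate_stirling1 /fps_scale.
set f := (X in fps_exp X _).
have f0 : f 0%N = 0.
  by rewrite /f /fps_neg_var /degenerate_log /fps_scale /fps_sub
    /fps_binomial /fps_one big_ord0 fact0 divr1 subrr !mulr0.
move=> ltnk; suff -> : fps_exp f k n = 0 by rewrite !mulr0.
elim: k n ltnk => // k IHk n ltnk.
rewrite /fps_exp iterS -/(fps_exp f k) /fps_mul big1 // => -[[|i] lti] _ /=.
  by rewrite f0 mul0r.
by rewrite IHk ?mulr0 //; case: n ltnk lti => // n ltnk _;
  rewrite subSS (leq_ltn_trans (leq_subr _ _)).
Qed.

End FormalPowerSeries.

Section Polynomials.
Variables (R : fieldType) (lambda : R).

(* (x)_{k,lambda} *)
Definition degenerate_falling (k : nat) : {poly R} :=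
  \prod_(i < k) ('X - (i%:R * lambda)%:P).

Definition K_poly (n : nat) : {poly R} :=
  n`!%:R * \sum_(k < n.+1)
    ('C(n + k + 1, n - k)%:R / k`!%:R) *: degenerate_falling k.

(* In J_poly and L_poly the factor n annihilates the second term at n = 0. *)
Definition J_poly (n : nat) : {poly R} := K_poly n - n%:R * K_poly n.-1.

Definition L_poly (n : nat) : {poly R} := J_poly n - n%:R * J_poly n.-1.

End Polynomials.

(* Main.v *)
Require Import Defs.
From HB Require Import structures.
From mathcomp Require Import all_boot all_order all_algebra.
From mathcomp Require Import reals.
From mathcomp Require Import ring.
Set Implicit Arguments.
Unset Strict Implicit.
Unset Printing Implicit Defensive.
Import Order.TTheory GRing.Theory Num.Theory.
Local Open Scope ring_scope.

(** The exponential generating series of L is (1 - t) times that of J, so the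
   identity says that the inner sums have generating series 1 / (1 - t), that
   is, that the inner sum of index m is m!.  Analytically, with
   u = - log_{-lambda}(1 - t) = ((1 - t)^{-lambda} - 1) / lambda, the binomial
   series gives sum_k (1)_{k,lambda} u^k / k! = (1 + lambda u)^{1 / lambda}
   = 1 / (1 - t).

   The proof avoids composing power series.  Since
   (1 - t) u' = (1 - t)^{-lambda} = 1 + lambda u, applying the derivation
   (1 - t) d/dt to u^k / k! yields the recurrence
   [n+1, k+1] = [n, k] + (n + lambda (k + 1)) [n, k+1]
   ([degenerate_stirling1_recurrence]).  Together with
   (x)_{k+1} = (x)_k (x - k lambda), it shows by induction that
   sum_k (x)_k [n, k] = x (x + 1) ... (x + n - 1)
   ([sum_degenerate_falling_stirling1]), which is n! at x = 1.  What remains,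
   sum_m n (n - 1) ... (n - m + 1) L_{n-m} = J_n, telescopes. *)

(** * The derivation (1 - t) d/dt on power series *)

Section Derivation.
Variable R : fieldType.
Implicit Types f g : fps R.

(** This is (1 - t) d/dt. *)
Definition fps_deriv_1subt f : fps R :=
  fun n => n.+1%:R * f n.+1 - n%:R * f n.

(** Both d/dt and t d/dt obey the Leibniz rule: the degree of a monomial of a
   product is the sum of the degrees of its factors. *)
Lemma fps_deriv_1subtM f g n :
  fps_deriv_1subt (fps_mul f g) n =
  fps_mul (fps_deriv_1subt f) g n + fps_mul f (fps_deriv_1subt g) n.
Proof.
have leibniz_deg m : m%:R * fps_mul f g m =
    \sum_(i < m.+1) i%:R * f i * g (m - i)%N +
    \sum_(i < m.+1) f i * ((m - i)%:R * g (m - i)%N).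
  rewrite /fps_mul mulr_sumr -big_split; apply: eq_bigr => -[i lti] _ /=.
  rewrite -{1}(subnKC (ltnSE lti)) natrD; ring.
rewrite /fps_deriv_1subt !leibniz_deg.
(* In degree n + 1, the monomials of degree 0 in the differentiated factor
   contribute nothing. *)
rewrite [X in X + _ - _]big_ord_recl !mul0r add0r.
rewrite [X in _ + X - _]big_ord_recr /= subnn mul0r mulr0 addr0.
rewrite opprD addrACA -!sumrB; congr (_ + _); apply: eq_bigr => -[i lti] _ /=.
  by rewrite /bump /= add1n subSS mulrBl.
by rewrite (subSn (ltnSE lti)) mulrBr.
Qed.

Lemma fps_deriv_1subt_one n : fps_deriv_1subt (@fps_one R) n = 0.
Proof.
by case: n => [|n]; rewrite /fps_deriv_1subt /fps_one !(mulr0, mul0r) subrr.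
Qed.

Lemma fps_mul1l f n : fps_mul (@fps_one R) f n = f n.
Proof.
rewrite /fps_mul big_ord_recl mul1r subn0 big1 ?addr0 // => i _.
by rewrite /fps_one mul0r.
Qed.

(** A solution of (1 - t) u' = 1 + lambda u satisfies
   (1 - t) (u^k)' = k (u^{k-1} + lambda u^k). *)
Lemma fps_deriv_1subt_exp (lambda : R) (u : fps R) k n :
    (forall m, fps_deriv_1subt u m = fps_one R m + lambda * u m) ->
  fps_deriv_1subt (fps_exp u k.+1) n =
  k.+1%:R * (fps_exp u k n + lambda * fps_exp u k.+1 n).
Proof.
move=> ode.
have odeM f m :
    fps_mul (fps_deriv_1subt u) f m = f m + lambda * fps_mul u f m.
  rewrite -[f m in RHS]fps_mul1l /fps_mul mulr_sumr -big_split.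
  by apply: eq_bigr => i _; rewrite ode mulrDl mulrA.
have expS j : fps_exp u j.+1 = fps_mul u (fps_exp u j) by [].
elim: k n => [|k IHk] n; rewrite [in LHS]expS fps_deriv_1subtM odeM -expS.
  rewrite [X in _ + X]big1 => [|i _]; first by rewrite addr0 mul1r.
  by rewrite fps_deriv_1subt_one mulr0.
have -> : fps_mul u (fps_deriv_1subt (fps_exp u k.+1)) n =
    k.+1%:R * (fps_exp u k.+1 n + lambda * fps_exp u k.+2 n).
  rewrite [fps_exp u k.+2]expS [X in X n + _]expS /fps_mul.
  rewrite mulrDr !mulr_sumr -big_split.
  by apply: eq_bigr => i _; rewrite IHk /=; ring.
by rewrite -[k.+2%:R]natr1; ring.
Qed.

End Derivation.

(** * Degenerate Stirling numbers of the first kind *)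

Section DegenerateStirling.
Variables (R : numFieldType) (lambda : R).
Hypothesis lambda_neq0 : lambda != 0.

(** - log_{-lambda}(1 - t) *)
Let u : fps R := fps_scale (-1) (fps_neg_var (degenerate_log (- lambda))).

(** Both sides are (1 - t)^{-lambda}. *)
Lemma fps_deriv_1subt_degenerate_log n :
  fps_deriv_1subt u n = fps_one R n + lambda * u n.
Proof.
rewrite /fps_deriv_1subt /u /fps_scale /fps_neg_var /degenerate_log /fps_scale.
rewrite /fps_sub /fps_one /fps_binomial big_ord_recr /= factS natrM exprS.
have fact_neq0 : n`!%:R != 0 :> R by rewrite pnatr_eq0 -lt0n fact_gt0.
have Sn_neq0 : n.+1%:R != 0 :> R by rewrite pnatr_eq0.
rewrite -[n.+1%:R]natr1 in Sn_neq0 *.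
case: n fact_neq0 Sn_neq0 => [|n] fact_neq0 Sn_neq0.
  by rewrite big_ord0 /= fact0; field.
move: n.+1%:R (n.+1)`!%:R fact_neq0 Sn_neq0 => d e e_neq0 d_neq0 /=.
by field; rewrite lambda_neq0 e_neq0 d_neq0.
Qed.

Lemma degenerate_stirling1_recurrence n k :
  degenerate_stirling1 (- lambda) n.+1 k.+1 =
  degenerate_stirling1 (- lambda) n k +
  (n%:R + lambda * k.+1%:R) * degenerate_stirling1 (- lambda) n k.+1.
Proof.
have := fps_deriv_1subt_exp k n fps_deriv_1subt_degenerate_log.
rewrite /fps_deriv_1subt => /(canRL (subrK _)) coefS.
rewrite /degenerate_stirling1 /fps_scale -/u factS [(k.+1)`!]factS !natrM.
have kfact_neq0 : k`!%:R != 0 :> R by rewrite pnatr_eq0 -lt0n fact_gt0.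
have Sk_neq0 : k.+1%:R != 0 :> R by rewrite pnatr_eq0.
transitivity (n`!%:R * ((k.+1%:R * k`!%:R)^-1 *
  (n.+1%:R * fps_exp u k.+1 n.+1))); first by ring.
rewrite coefS; field.
by rewrite addrC natr1 kfact_neq0 Sk_neq0.
Qed.

Lemma degenerate_stirling1S0 mu n : degenerate_stirling1 mu n.+1 0 = 0 :> R.
Proof. by rewrite /degenerate_stirling1 /fps_scale /= /fps_one !mulr0. Qed.

(** The factor x - k lambda by which (x)_{k+1} extends (x)_k and the factor
   n + lambda k of the recurrence add up to x + n, whatever k is. *)
Lemma sum_degenerate_falling_stirling1 (x : R) n :
  \sum_(k < n.+1) (degenerate_falling lambda k).[x] *
                  degenerate_stirling1 (- lambda) n k =
  \prod_(i < n) (x + i%:R).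
Proof.
have fallingS k : (degenerate_falling lambda k.+1).[x] =
    (degenerate_falling lambda k).[x] * (x - k%:R * lambda).
  by rewrite /degenerate_falling big_ord_recr /= hornerM !hornerE.
elim: n => [|n IHn].
  rewrite big_ord1 !big_ord0 /degenerate_falling big_ord0 hornerC.
  by rewrite /degenerate_stirling1 /fps_scale /fps_exp /= /fps_one
    fact0 invr1 !mul1r.
rewrite [RHS]big_ord_recr /= -IHn mulr_suml.
rewrite [LHS]big_ord_recl degenerate_stirling1S0 mulr0 add0r.
pose S k := (degenerate_falling lambda k).[x] * (n%:R + lambda * k%:R) *
  degenerate_stirling1 (- lambda) n k.
transitivity (\sum_(k < n.+1) (degenerate_falling lambda k.+1).[x] *
    degenerate_stirling1 (- lambda) n k + \sum_(k < n.+1) S k.+1).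
  rewrite -big_split; apply: eq_bigr => k _ /=.
  by rewrite /bump /= add1n degenerate_stirling1_recurrence /S; ring.
(* S 0 vanishes through its factor n if n = 0 and through [n, 0] otherwise,
   and S (n + 1) through [n, n+1]: the second sum may run from 0 to n. *)
have -> : \sum_(k < n.+1) S k.+1 = \sum_(k < n.+1) S k.
  have S0 : S 0%N = 0.
    by case: (n) @S => [|n'] /=;
      rewrite ?degenerate_stirling1S0 !(mulr0, addr0, mul0r).
  have Sn : S n.+1 = 0 by rewrite /S degenerate_stirling1_small ?mulr0.
  by rewrite big_ord_recr /= Sn addr0 big_ord_recl S0 add0r.
by rewrite -big_split; apply: eq_bigr => k _; rewrite /S fallingS /=; ring.
Qed.

End DegenerateStirling.

(** * Inverting the difference that defines L *)

(** Inverting J |-> L amounts to dividing generating series by 1 - t. *)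
Lemma J_poly_sum_L_poly (F : fieldType) (lambda : F) n :
  J_poly lambda n = \sum_(m < n.+1) (n ^_ m)%:R * L_poly lambda (n - m).
Proof.
pose T m := (n ^_ m)%:R * J_poly lambda (n - m).
have -> : J_poly lambda n = T 0%N - T n.+1.
  by rewrite /T ffactn0 subn0 mul1r ffact_small // mul0r subr0.
rewrite -opprB -(telescope_sumr _ (leq0n n.+1)) big_mkord -sumrN.
apply: eq_bigr => m _; rewrite opprB /T /L_poly ffactnSr natrM subnS; ring.
Qed.

Theorem theorem4p2 (R : realType) (lambda : R) (lambda_neq0 : lambda != 0)
    (n : nat) :
  J_poly lambda n =
  \sum_(m < n.+1) 'C(n, m)%:R * L_poly lambda (n - m) *
    (\sum_(k < m.+1) (degenerate_falling lambda k).[1] *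
                     degenerate_stirling1 (- lambda) m k)%:P.
Proof.
rewrite J_poly_sum_L_poly; apply: eq_bigr => m _.
rewrite sum_degenerate_falling_stirling1 //.
have -> : \prod_(i < m) (1 + i%:R) = m`!%:R :> R.
  rewrite fact_prod natr_prod big_add1 big_mkord.
  by apply: eq_bigr => i _; rewrite nat1r.
by rewrite -bin_ffact natrM mulrAC polyC_natr.
Qed.
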